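(* Let $\mathsf{PAs}^{\leftarrow}$ be the graded vector space such that for each $n\geq 1$, $\mathsf{PAs}^{\leftarrow}(n)$ has basis $\{\mathsf{E}_u : u \in \mathfrak{P}[n]\}$, where $\mathfrak{P}[n]$ is the (infinite) set of packed words with set of letters exactly $[n]$. For $u \in \mathfrak{P}[n]$, $i \in [n]$ and $v \in \mathfrak{P}[m]$, define $\mathsf{E}_u \circ_i \mathsf{E}_v := \mathsf{E}_w$, where $w$ is the word obtained from $\mathrm{inc}_{m-1,i}(u)$ by replacing every occurrence of the letter $i$ by the word $\mathrm{inc}_{i-1,0}(v)$ (so $w \in \mathfrak{P}[n+m-1]$), extended bilinearly. For $u \in \mathfrak{P}[n]$ of length $\ell$ and $\sigma \in \mathfrak{S}_n$, define $\mathsf{E}_u \cdot \sigma := \mathsf{E}_{\sigma^{-1}(u(1))\cdots\sigma^{-1}(u(\ell))}$, extended linearly. Then $\mathsf{PAs}^{\leftarrow}$, endowed with the partial compositions $\circ_i$ and the action $\cdot$ of the symmetric groups, is a symmetric (unital) operad, with unit $\mathsf{E}_1$.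
   Context: $\mathbb{P}=\{1,2,\dots\}$, $[n]=\{1,\dots,n\}$, $\mathfrak{S}_n$ is the symmetric group on $[n]$. A packed word is a word over $\mathbb{P}$ whose set of letters is $[k]$ for some $k$. For a word $u$, $u(j)$ is its $j$-th letter. $\mathrm{inc}_{\alpha,\beta}(u)$ is the word obtained from $u$ by adding $\alpha$ to each letter strictly greater than $\beta$. Example: $\mathsf{E}_{231314}\circ_3\mathsf{E}_{122} = \mathsf{E}_{2344134415}$, and $\mathsf{E}_{1411232}\cdot 3142 = \mathsf{E}_{2322414}$. A symmetric operad here means: partial compositions satisfying sequential and parallel associativity, a two-sided unit in arity $1$, right actions of $\mathfrak{S}_n$ on arity $n$ components, and the usual equivariance compatibility between partial compositions and the actions. *)

(* Defs.v *)
From HB Require Import structures.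
From mathcomp Require Import all_boot all_order all_algebra all_fingroup.
From mathcomp Require Import finmap.
From mathcomp Require Import monalg.
From mathcomp Require Import zify.

Set Implicit Arguments.
Unset Strict Implicit.
Unset Printing Implicit Defensive.

Import GRing.Theory.

(** Components exist in arities >= 1 only, and every index is shifted by one:
  [P n] is the component of arity [n.+1], an input is an element of ['I_n.+1]
  (the ordinal [i] is the input number [i.+1]), and [comp i : P n -> P m -> _]
  lands in arity [n.+1 + m.+1 - 1 = (n + m).+1], that is in [P (n + m)]. *)

(** The permutation [s o_i t] of the equivariance axiom.  In one-line notation
  it is obtained from [s] by adding [m] (one less than the degree of [t]) to
  the letters greater than [s i], and by replacing the letter [s i] by the word
  of [t] shifted so that its values fill the interval [s i, s i + m]. *)
Definition bump_over (m c a : nat) : nat := if c < a then a + m else a.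

Definition perm_comp_fun n m (s : 'S_n.+1) (i : 'I_n.+1) (t : 'S_m.+1)
    (k : 'I_(n + m).+1) : 'I_(n + m).+1 :=
  inord (if k < i then bump_over m (s i) (s (inord k))
         else if k <= i + m then s i + t (inord (k - i))
         else bump_over m (s i) (s (inord (k - m)))).

Lemma perm_comp_inj n m (s : 'S_n.+1) (i : 'I_n.+1) (t : 'S_m.+1) :
  injective (perm_comp_fun s i t).
Proof.
have sP a (an : a <= n) :
    (a != i -> (s (inord a) : nat) <> s i) /\ (s (inord a) <= n).
  split; last by rewrite -ltnS.
  move=> ai /val_inj/perm_inj/(congr1 val); rewrite /= inordK ?ltnS // => e.
  by rewrite e eqxx in ai.
have sI a b : a <= n -> b <= n -> (s (inord a) : nat) = s (inord b) -> a = b.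
  move=> an bn /val_inj/perm_inj/(congr1 val).
  by rewrite /= !inordK ?ltnS.
have tI a b : a <= m -> b <= m -> (t (inord a) : nat) = t (inord b) -> a = b.
  move=> an bn /val_inj/perm_inj/(congr1 val).
  by rewrite /= !inordK ?ltnS.
have tP a : t (inord a) <= m by rewrite -ltnS.
have ip := ltn_ord i; have sip : s i <= n by rewrite -ltnS.
move=> k l /(congr1 val) /=; rewrite /perm_comp_fun.
have kp := ltn_ord k; have lp := ltn_ord l.
have bnd (x : 'I_(n + m).+1) : (if x < i then bump_over m (s i) (s (inord x))
         else if x <= i + m then s i + t (inord (x - i))
         else bump_over m (s i) (s (inord (x - m)))) < (n + m).+1.
  have xp := ltn_ord x; rewrite /bump_over.
  have := tP (x - i); have := ltn_ord (s (inord x)).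
  have := ltn_ord (s (inord (x - m))).
  by move: {xp}(nat_of_ord x) => y; do !case: ifP; lia.
rewrite !inordK ?bnd // /bump_over => E; apply: val_inj; move: E => /=.
move: tP (sP) sI tI (tP (k - i)) (tP (l - i)).
move: (nat_of_ord k) (nat_of_ord l) kp lp => {}k {}l kp lp _ sP' sI tI tk tl.
case: (ltnP k i) => ki; case: (ltnP l i) => li.
- have [|k1 _] := sP' k; first lia.
  have [|l1 _] := sP' l; first lia.
  have := sI k l.
  by move: (k1 ltac:(lia)) (l1 ltac:(lia)); do 2?case: ifP; lia.
- have [|k1 _] := sP' k; first lia.
  case: (leqP l (i + m)) => lim; first by move: (k1 ltac:(lia)); case: ifP; lia.
  have [|l1 _] := sP' (l - m); first lia.
  have := sI k (l - m).
  by move: (k1 ltac:(lia)) (l1 ltac:(lia)); do 2?case: ifP; lia.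
- have [|l1 _] := sP' l; first lia.
  case: (leqP k (i + m)) => kim; first by move: (l1 ltac:(lia)); case: ifP; lia.
  have [|k1 _] := sP' (k - m); first lia.
  have := sI (k - m) l.
  by move: (k1 ltac:(lia)) (l1 ltac:(lia)); do 2?case: ifP; lia.
- case: (leqP k (i + m)) => kim; case: (leqP l (i + m)) => lim.
  + by have := tI (k - i) (l - i); lia.
  + have [|l1 _] := sP' (l - m); first lia.
    by move: (l1 ltac:(lia)); case: ifP; lia.
  + have [|k1 _] := sP' (k - m); first lia.
    by move: (k1 ltac:(lia)); case: ifP; lia.
  + have [|k1 _] := sP' (k - m); first lia.
    have [|l1 _] := sP' (l - m); first lia.
    have := sI (k - m) (l - m); move: (k1 ltac:(lia)) (l1 ltac:(lia)).
    by do 2?case: ifP; lia.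
Qed.

Definition perm_comp n m (s : 'S_n.+1) (i : 'I_n.+1) (t : 'S_m.+1) :
  'S_(n + m).+1 := perm (@perm_comp_inj n m s i t).

Section SymmetricOperad.
Local Open Scope ring_scope.

Variables (K : fieldType) (P : nat -> lmodType K).
Variable comp : forall n m : nat, 'I_n.+1 -> P n -> P m -> P (n + m)%N.
Variable act : forall n : nat, P n -> 'S_n.+1 -> P n.
Variable unit : P 0%N.

Local Notation "x ∘[ i ] y" := (comp i x y)
  (at level 39, i at level 99, left associativity, format "x  ∘[ i ]  y").
Local Notation "x · s" := (act x s) (at level 38, left associativity).
Local Notation cast e x := (ecast k (P k) e x).

(** All the [inord] indices below are in range.  In [act_mul], the product of the symmetric group is the composition of
  functions, [s t : k |-> s (t k)]; MathComp composes permutations from left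
  to right and writes it [(t * s)%g]. *)
Record symmetric_operad : Prop := SymmetricOperad {
  comp_linearl : forall n m (i : 'I_n.+1) (a : K) (x x' : P n) (y : P m),
    (a *: x + x') ∘[i] y = a *: (x ∘[i] y) + x' ∘[i] y;
  comp_linearr : forall n m (i : 'I_n.+1) (a : K) (x : P n) (y y' : P m),
    x ∘[i] (a *: y + y') = a *: (x ∘[i] y) + x ∘[i] y';
  comp_seq : forall n m p (i : 'I_n.+1) (j : 'I_m.+1)
      (x : P n) (y : P m) (z : P p),
    x ∘[i] (y ∘[j] z)
      = cast (esym (addnA n m p)) ((x ∘[i] y) ∘[inord (i + j)] z);
  comp_par : forall n m p (i j : 'I_n.+1) (x : P n) (y : P m) (z : P p),
    (i < j)%N ->
    (x ∘[j] z) ∘[inord i] y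
      = cast (addnAC n m p) ((x ∘[i] y) ∘[inord (j + m)] z);
  comp_unitl : forall n (x : P n), unit ∘[ord0] x = x;
  comp_unitr : forall n (i : 'I_n.+1) (x : P n),
    cast (addn0 n) (x ∘[i] unit) = x;
  act_linear : forall n (s : 'S_n.+1) (a : K) (x y : P n),
    (a *: x + y) · s = a *: (x · s) + y · s;
  act_one : forall n (x : P n), x · 1%g = x;
  act_mul : forall n (s t : 'S_n.+1) (x : P n),
    (x · s) · t = x · (t * s)%g;
  comp_equivariant : forall n m (i : 'I_n.+1) (s : 'S_n.+1) (t : 'S_m.+1)
      (x : P n) (y : P m),
    (x · s) ∘[i] (y · t) = (x ∘[s i] y) · perm_comp s i t
}.

End SymmetricOperad.

(** Letters of words are numbered from 1, so the input [i : 'I_n.+1] of a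
  component corresponds to the letter [i.+1]. *)

Definition inc (a b : nat) (u : seq nat) : seq nat :=
  [seq if b < x then x + a else x | x <- u].

Definition word_comp (m i : nat) (u v : seq nat) : seq nat :=
  flatten [seq if x == i then inc (i - 1) 0 v else [:: x]
          | x <- inc (m - 1) i u].

Definition word_act n (u : seq nat) (s : 'S_n.+1) : seq nat :=
  [seq ((s^-1)%g (inord x.-1)).+1 | x <- u].

Definition packed_on (n : nat) (u : seq nat) : bool :=
  all (fun x => 1 <= x <= n) u && all (fun a => a \in u) (iota 1 n).

Lemma packed_onP n u :
  reflect (forall x, (x \in u) = (1 <= x <= n)) (packed_on n u).
Proof.
apply: (iffP andP) => [[/allP h1 /allP h2] x|h].
  apply/idP/idP => [/h1 //|hx]; apply: h2.
  by rewrite mem_iota; lia.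
split; apply/allP => x; first by rewrite h.
by rewrite mem_iota h; lia.
Qed.

Record packed (n : nat) :=
  Packed { packed_word :> seq nat; packed_wordP : packed_on n packed_word }.

HB.instance Definition _ n := [isSub for @packed_word n].
HB.instance Definition _ n := [Choice of packed n by <:].

Lemma mem_inc a b u y :
  reflect (exists2 x, x \in u & y = if b < x then x + a else x)
    (y \in inc a b u).
Proof. exact: mapP. Qed.

Lemma mem_word_comp m i u v y :
  reflect (exists2 x, x \in inc (m - 1) i u &
             y \in if x == i then inc (i - 1) 0 v else [:: x])
    (y \in word_comp m i u v).
Proof. exact: flatten_mapP. Qed.

Lemma packed_word_comp n m (i : 'I_n.+1) u v :
  packed_on n.+1 u -> packed_on m.+1 v ->
  packed_on (n + m).+1 (word_comp m.+1 i.+1 u v).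
Proof.
move=> /packed_onP hu /packed_onP hv; apply/packed_onP => y.
have ip := ltn_ord i; apply/mem_word_comp/idP.
  case=> x /mem_inc[z]; rewrite hu => hz ->.
  have [_|_] := eqVneq; last by rewrite inE => /eqP ->; case: ifP; lia.
  by move=> /mem_inc[t]; rewrite hv => ht ->; case: ifP; lia.
move=> hy; have [yi|iy] := ltnP y i.+1.
  exists y; last by rewrite ifN ?inE //; lia.
  by apply/mem_inc; exists y; [rewrite hu; lia|rewrite ifN //; lia].
have [yim|imy] := leqP y (i.+1 + m).
  exists i.+1; last rewrite eqxx.
    by apply/mem_inc; exists i.+1; [rewrite hu; lia|rewrite ltnn].
  apply/mem_inc; exists (y - i); first by rewrite hv; lia.
  by case: ifP; lia.
exists y; last by rewrite ifN ?inE //; lia.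
by apply/mem_inc; exists (y - m); [rewrite hu; lia|case: ifP; lia].
Qed.

Lemma packed_word_act n (s : 'S_n.+1) u :
  packed_on n.+1 u -> packed_on n.+1 (word_act u s).
Proof.
move=> /packed_onP hu; apply/packed_onP => y; apply/mapP/idP.
  by case=> x _ ->; have := ltn_ord ((s^-1)%g (inord x.-1)); lia.
move=> hy; exists (s (inord y.-1)).+1.
  by rewrite hu; have := ltn_ord (s (inord y.-1)); lia.
by rewrite /= inord_val permK inordK; lia.
Qed.

Definition packed_comp n m (i : 'I_n.+1) (u : packed n.+1) (v : packed m.+1) :
  packed (n + m).+1 :=
  Packed (packed_word_comp i (packed_wordP u) (packed_wordP v)).

Definition packed_act n (u : packed n.+1) (s : 'S_n.+1) : packed n.+1 :=
  Packed (packed_word_act s (packed_wordP u)).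

Lemma packed_one_proof : packed_on 1 [:: 1]. Proof. by []. Qed.
Definition packed_one : packed 1 := Packed packed_one_proof.

Section PAs.
Local Open Scope ring_scope.

Variable K : fieldType.

Definition lin_ext (B : choiceType) (V : lmodType K) (f : B -> V)
    (x : {malg K[B]}) : V :=
  \sum_(u <- msupp x) x@_u *: f u.

Lemma lin_extE (B : choiceType) (V : lmodType K) (f : B -> V) (b : B) :
  lin_ext f << b >> = f b.
Proof.
by rewrite /lin_ext msuppU oner_eq0 big_seq_fset1 mcoeffUU scale1r.
Qed.

Definition PAs (n : nat) : lmodType K := {malg K[packed n.+1]}.

Definition E n (u : packed n.+1) : PAs n := << u >>.

Definition PAs_comp n m (i : 'I_n.+1) (x : PAs n) (y : PAs m) : PAs (n + m)%N :=
  lin_ext (fun u => lin_ext (fun v => E (packed_comp i u v)) y) x.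

Definition PAs_act n (x : PAs n) (s : 'S_n.+1) : PAs n :=
  lin_ext (fun u => E (packed_act u s)) x.

Definition PAs_unit : PAs 0 := E packed_one.

Lemma PAs_compE n m (i : 'I_n.+1) (u : packed n.+1) (v : packed m.+1) :
  PAs_comp i (E u) (E v) = E (packed_comp i u v).
Proof. by rewrite /PAs_comp !lin_extE. Qed.

Lemma PAs_actE n (u : packed n.+1) (s : 'S_n.+1) :
  PAs_act (E u) s = E (packed_act u s).
Proof. by rewrite /PAs_act lin_extE. Qed.

End PAs.

(* Main.v *)
(** Composition of packed words is a letterwise substitution, hence a monoid
  morphism for concatenation in its left argument, and the action is letterwise
  too.  By multilinearity every operad axiom reduces to basis elements, and then
  to words with a single letter on the left, where it is a comparison of
  shifted letters. *)

Require Import Defs.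
From mathcomp Require Import all_boot all_algebra.
From mathcomp Require Import all_fingroup finmap monalg zify.

Set Implicit Arguments.
Unset Strict Implicit.
Unset Printing Implicit Defensive.

Import GRing.Theory.

(** * Multilinearity and reduction to basis elements *)

Section LinearExtension.
Local Open Scope ring_scope.
Variable K : fieldType.

(** Coefficients vanish off the support, so any finite set containing it can index the sum; vectors
    with different supports then become comparable term by term. *)
Lemma lin_extEw (B : choiceType) (V : lmodType K) (f : B -> V)
    (D : {fset B}) (x : {malg K[B]}) :
  (msupp x `<=` D)%fset -> lin_ext f x = \sum_(u <- D) x@_u *: f u.
Proof.
move=> xD; apply: big_fset_incl => // u _ /mcoeff_outdom ->.
by rewrite scale0r.
Qed.

Lemma lin_ext_is_linear (B : choiceType) (V : lmodType K) (f : B -> V) :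
  linear (lin_ext f).
Proof.
move=> a x y; pose D := (msupp x `|` msupp y `|` msupp (a *: x + y))%fset.
have xD : (msupp x `<=` D)%fset.
  exact: fsubset_trans (fsubsetUl _ (msupp y)) (fsubsetUl _ _).
have yD : (msupp y `<=` D)%fset.
  exact: fsubset_trans (fsubsetUr (msupp x) _) (fsubsetUl _ _).
have axyD : (msupp (a *: x + y) `<=` D)%fset by exact: fsubsetUr.
rewrite (lin_extEw _ xD) (lin_extEw _ yD) (lin_extEw _ axyD).
rewrite scaler_sumr -big_split /=; apply: eq_bigr => u _.
by rewrite mcoeffD mcoeffZ scalerDl scalerA.
Qed.

Lemma linear_eq_lin_ext (B : choiceType) (V : lmodType K)
    (g : {malg K[B]} -> V) :
  linear g -> g =1 lin_ext (fun u => g << u >>).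
Proof.
move=> lg x.
(* Linearity is a single identity here: the scalar -1 at 0 gives [g 0 = 0], a zero second argument
   gives homogeneity, the scalar 1 gives additivity. *)
have g0 : g 0 = 0 by have := lg (-1) 0 0; rewrite scaler0 addr0 scaleN1r addNr.
have gZ a y : g (a *: y) = a *: g y by have := lg a y 0; rewrite g0 !addr0.
have gD y z : g (y + z) = g y + g z by have := lg 1 y z; rewrite !scale1r.
rewrite /lin_ext {1}(monalgE x) (big_morph g gD g0).
apply: eq_bigr => u _; rewrite -gZ; congr g.
by apply/malgP => v; rewrite mcoeffZ !mcoeffU mulrnAr mulr1.
Qed.

Lemma linear_basis_ext (B : choiceType) (V : lmodType K)
    (g h : {malg K[B]} -> V) :
  linear g -> linear h -> (forall u, g << u >> = h << u >>) -> g =1 h.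
Proof.
move=> lg lh gh x; rewrite (linear_eq_lin_ext lg) (linear_eq_lin_ext lh).
by apply: eq_bigr => u _; rewrite gh.
Qed.

(** Needed for the right argument of the composition, which sits inside the outer extension;
    commutativity of [K] lets the scalar pass the coefficients of [x]. *)
Lemma lin_ext_linear_fun (B : choiceType) (U V : lmodType K)
    (f : B -> U -> V) (x : {malg K[B]}) :
  (forall u, linear (f u)) -> linear (fun y => lin_ext (f^~ y) x).
Proof.
move=> lf a y z; rewrite /lin_ext scaler_sumr -big_split /=.
by apply: eq_bigr => u _; rewrite lf scalerDr !scalerA mulrC.
Qed.

Lemma PAs_comp_linearl n m (i : 'I_n.+1) (y : PAs K m) :
  linear (fun x : PAs K n => PAs_comp i x y).
Proof. exact: lin_ext_is_linear. Qed.

Lemma PAs_comp_linearr n m (i : 'I_n.+1) (x : PAs K n) :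
  linear (fun y : PAs K m => PAs_comp i x y).
Proof. by apply: lin_ext_linear_fun => u; apply: lin_ext_is_linear. Qed.

Lemma PAs_act_linear n (s : 'S_n.+1) :
  linear (fun x : PAs K n => PAs_act x s).
Proof. exact: lin_ext_is_linear. Qed.

Lemma cast_linear (P : nat -> lmodType K) n m (e : n = m) :
  linear (fun x : P n => ecast k (P k) e x).
Proof. by case: m / e. Qed.

Lemma linear_comp (U V W : lmodType K) (g : V -> W) (f : U -> V) :
  linear g -> linear f -> linear (fun x => g (f x)).
Proof. by move=> lg lf a x y; rewrite lf lg. Qed.

(** Removes the arity transports: once [e] is eliminated, packed words with the same underlying
    sequence coincide, so only words remain to be compared. *)
Lemma cast_E n m (e : n = m) (u : packed n.+1) (v : packed m.+1) :
  packed_word u = packed_word v -> ecast k (PAs K k) e (E K u) = E K v.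
Proof. by case: m / e v => v uv /=; congr (E K _); apply: val_inj. Qed.

End LinearExtension.

(** * Substitution in words: associativity and units *)

Lemma word_comp_cat m i u1 u2 v :
  word_comp m i (u1 ++ u2) v = word_comp m i u1 v ++ word_comp m i u2 v.
Proof. by rewrite /word_comp /inc !map_cat flatten_cat. Qed.

Lemma word_comp_cons m i x u v :
  word_comp m i (x :: u) v = word_comp m i [:: x] v ++ word_comp m i u v.
Proof. by rewrite -cat1s word_comp_cat. Qed.

Lemma word_comp_lt m i x v : x < i -> word_comp m i [:: x] v = [:: x].
Proof. by rewrite /word_comp /= => xi; rewrite !ifN //; lia. Qed.

Lemma word_comp_gt m i x v :
  i < x -> word_comp m.+1 i [:: x] v = [:: x + m].
Proof. by rewrite /word_comp /= => xi; rewrite xi subn1 ifN //; lia. Qed.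

Lemma word_comp_eq m i v :
  word_comp m i.+1 [:: i.+1] v = inc i 0 v.
Proof. by rewrite /word_comp /= ltnn eqxx subn1 cats0. Qed.

Lemma inc_cat a b u v : inc a b (u ++ v) = inc a b u ++ inc a b v.
Proof. exact: map_cat. Qed.

(** Positivity of [v] makes [inc i 0] a translation by [i] of all its letters, and translating the
    word also translates the letter being substituted. *)
Lemma inc_word_comp p i j v w : all (leq 1) v ->
  inc i 0 (word_comp p.+1 j.+1 v w) = word_comp p.+1 (i + j).+1 (inc i 0 v) w.
Proof.
elim: v => [//|x v IH] /= /andP[x1 v1].
rewrite (word_comp_cons _ _ x v) (word_comp_cons _ _ _ (inc i 0 v)).
rewrite inc_cat -(IH v1) x1; congr (_ ++ _).
case: (ltngtP x j.+1) => xj.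
- by rewrite !word_comp_lt /= ?x1 //; lia.
- by rewrite !word_comp_gt /= ?ifT //; [congr [:: _]|..]; lia.
- rewrite xj addSn [j + i]addnC !word_comp_eq /inc -map_comp; apply: eq_map => y /=.
  by do !case: ifP; lia.
Qed.

(** Letters above [i.+1] move by [m], and [j <= m] puts them beyond [(i + j).+1], so they move again
    by [p]. The letter [i.+1] itself is the case of [inc_word_comp]. *)
Lemma word_comp_seq m p i j u v w : all (leq 1) v -> j <= m ->
  word_comp (m + p).+1 i.+1 u (word_comp p.+1 j.+1 v w)
    = word_comp p.+1 (i + j).+1 (word_comp m.+1 i.+1 u v) w.
Proof.
move=> v1 jm; elim: u => [//|x u IH].
rewrite word_comp_cons (word_comp_cons m.+1) word_comp_cat -IH; congr (_ ++ _).
case: (ltngtP x i.+1) => xi.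
- by rewrite !word_comp_lt //; lia.
- by rewrite !word_comp_gt //; [congr [:: _]|..]; lia.
- by rewrite xi !word_comp_eq inc_word_comp.
Qed.

Lemma word_comp_outl m i u v :
  all (fun x => x < i) u -> word_comp m i u v = u.
Proof.
elim: u => [//|x u IH] /= /andP[xi ui].
by rewrite word_comp_cons word_comp_lt // IH.
Qed.

Lemma word_comp_outr m i u v :
  all (fun x => i < x) u -> word_comp m.+1 i u v = [seq x + m | x <- u].
Proof.
elim: u => [//|x u IH] /= /andP[xi ui].
by rewrite word_comp_cons word_comp_gt // IH.
Qed.

Lemma word_comp_par m p i j u v w :
  i < j -> all (fun x => 1 <= x <= m.+1) v -> all (leq 1) w ->
  word_comp m.+1 i.+1 (word_comp p.+1 j.+1 u w) v
    = word_comp p.+1 (j + m).+1 (word_comp m.+1 i.+1 u v) w.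
Proof.
move=> ij /allP vm /allP w1; elim: u => [//|x u IH].
rewrite (word_comp_cons p.+1) (word_comp_cons m.+1 i.+1 x).
rewrite (word_comp_cat m.+1 _ (word_comp p.+1 j.+1 [:: x] w)).
rewrite (word_comp_cat p.+1 _ (word_comp m.+1 i.+1 [:: x] v)) IH.
congr (_ ++ _); case: (ltngtP x i.+1) => xi.
- by rewrite !word_comp_lt //; lia.
- case: (ltngtP x j.+1) => xj.
  + by rewrite word_comp_lt // word_comp_gt // word_comp_lt //; lia.
  + by rewrite !word_comp_gt //; [congr [:: _]|..]; lia.
  (* The inserted copy of [w] has letters at least [j.+1], all above [i.+1] as [i < j]: the second
     substitution only translates it by [m]. *)
  + rewrite xj word_comp_eq word_comp_gt // addSn word_comp_eq word_comp_outr.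
      rewrite /inc -map_comp; apply/eq_in_map => y /w1 y1 /=.
      by rewrite y1; lia.
    by apply/allP => y /mem_inc[z /w1 z1 ->]; rewrite z1; lia.
(* The inserted copy of [v] has letters at most [i + m.+1], hence below [(j + m).+1]: the second
   substitution leaves it fixed. *)
- rewrite xi word_comp_lt // word_comp_eq word_comp_outl //.
  by apply/allP => y /mem_inc[z /vm z1 ->]; case: ifP; lia.
Qed.

Lemma inc0 b u : inc 0 b u = u.
Proof. by elim: u => //= x u ->; rewrite addn0 if_same. Qed.

Lemma word_comp_unitl m v : word_comp m 1 [:: 1] v = v.
Proof. by rewrite word_comp_eq inc0. Qed.

Lemma word_comp_unitr i u : word_comp 1 i.+1 u [:: 1] = u.
Proof.
elim: u => [//|x u IH]; rewrite word_comp_cons IH -[RHS]cat1s; congr (_ ++ _).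
case: (ltngtP x i.+1) => xi; last by rewrite xi word_comp_eq.
  by rewrite word_comp_lt.
by rewrite word_comp_gt ?addn0.
Qed.

(** * The right action on words *)

Lemma packed_letters n (u : packed n) : all (fun x => 1 <= x <= n) u.
Proof. by have /andP[] := packed_wordP u. Qed.

Lemma packed_letters_gt0 n (u : packed n) : all (leq 1) u.
Proof. by apply: sub_all (packed_letters u) => x /andP[]. Qed.

Lemma word_act1 n u :
  all (fun x => 1 <= x <= n.+1) u -> word_act u (1%g : 'S_n.+1) = u.
Proof.
move=> /allP un; rewrite -[RHS]map_id; apply/eq_in_map => x /un xn.
by rewrite invg1 perm1 inordK; lia.
Qed.

(** The inverse in [word_act] is what makes this a right action: applying the inverse of [s] and
    then that of [t] inverts [s] after [t], written [t * s] in left-to-right order. *)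
Lemma word_actM n u (s t : 'S_n.+1) :
  word_act (word_act u s) t = word_act u (t * s)%g.
Proof.
rewrite /word_act -map_comp; apply: eq_map => x /=.
by rewrite invMg permM inord_val.
Qed.

Lemma word_act_cat n u v (s : 'S_n.+1) :
  word_act (u ++ v) s = word_act u s ++ word_act v s.
Proof. exact: map_cat. Qed.

(** * The block permutation and equivariance *)

Lemma perm_compE n m (s : 'S_n.+1) (i : 'I_n.+1) (t : 'S_m.+1)
    (k : 'I_(n + m).+1) :
  perm_comp s i t k = (if k < i then bump_over m (s i) (s (inord k))
         else if k <= i + m then s i + t (inord (k - i))
         else bump_over m (s i) (s (inord (k - m)))) :> nat.
Proof.
rewrite permE /perm_comp_fun inordK // /bump_over.
have := ltn_ord (t (inord (k - i))); have := ltn_ord (s (inord k)).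
have := ltn_ord (s (inord (k - m))); have := ltn_ord (s i).
by do !case: ifP; lia.
Qed.

(** With [a = s b], the claim becomes a forward evaluation: [perm_comp s i t] sends the bumped
    position of [b] to the bumped value of [s b]. No formula for the inverse is required. *)
Lemma perm_comp_inv_out n m (s : 'S_n.+1) (i : 'I_n.+1) (t : 'S_m.+1)
    (a : 'I_n.+1) : a != s i ->
  (perm_comp s i t)^-1%g (inord (bump_over m (s i) a))
    = bump_over m i (s^-1%g a) :> nat.
Proof.
rewrite -{1 2}(permKV s a); move: (s^-1%g a) => b.
rewrite (inj_eq perm_inj) => bi.
have bn := ltn_ord b.
have bL : bump_over m i b < (n + m).+1 by rewrite /bump_over; case: ifP; lia.
suff <- : perm_comp s i t (inord (bump_over m i b))
          = inord (bump_over m (s i) (s b)) by rewrite permK inordK.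
have {}bi : (b : nat) <> i by move=> /val_inj e; rewrite e eqxx in bi.
apply: val_inj; rewrite /= perm_compE !inordK //; last first.
  by have := ltn_ord (s b); rewrite /bump_over; case: ifP; lia.
(* For [b] above [i] the bumped position is past the block, so the third branch applies and
   subtracting [m] recovers [b]; below [i] the first branch applies. *)
case: (ltnP i b) => ib.
  have -> : bump_over m i b = b + m by rewrite /bump_over ib.
  by rewrite !ifN ?addnK ?inord_val //; lia.
have -> : bump_over m i b = b by rewrite /bump_over ifN //; lia.
by rewrite ifT ?inord_val //; lia.
Qed.

(** Same inversion trick, inside the block: position [i + b] goes to value [s i + t b]. *)
Lemma perm_comp_inv_in n m (s : 'S_n.+1) (i : 'I_n.+1) (t : 'S_m.+1)
    (a : 'I_m.+1) :
  (perm_comp s i t)^-1%g (inord (s i + a)) = i + t^-1%g a :> nat.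
Proof.
rewrite -{1}(permKV t a); move: (t^-1%g a) => b.
have bm := ltn_ord b; have ip := ltn_ord i.
suff <- : perm_comp s i t (inord (i + b)) = inord (s i + t b).
  by rewrite permK inordK; lia.
have tbm := ltn_ord (t b); have sin := ltn_ord (s i).
apply: val_inj; rewrite /= perm_compE.
rewrite (@inordK _ (i + b)); last by lia.
rewrite (@inordK _ (s i + t b)); last by lia.
by rewrite ifN ?ifT ?addKn ?inord_val //; lia.
Qed.

Lemma word_comp_equivariant n m (i : 'I_n.+1) (s : 'S_n.+1) (t : 'S_m.+1) u v :
  all (fun x => 1 <= x <= n.+1) u -> all (fun x => 1 <= x <= m.+1) v ->
  word_comp m.+1 i.+1 (word_act u s) (word_act v t)
    = word_act (word_comp m.+1 (s i).+1 u v) (perm_comp s i t).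
Proof.
move=> un /allP vm; elim: u un => [//|x u IH] /= /andP[xn un].
rewrite word_comp_cons (word_comp_cons _ _ x) word_act_cat -IH //.
congr (_ ++ _).
(* Letters are 1-based and permutations act on 0-based ordinals; writing the letter as [a.+1]
   cancels the predecessor in [word_act]. *)
have [a -> {x xn}] : exists a : 'I_n.+1, x = a.+1.
  by exists (inord x.-1); rewrite inordK; lia.
rewrite /= inord_val; have [->|asi] := eqVneq a (s i).
  rewrite permK !word_comp_eq /inc /word_act -!map_comp.
  apply/eq_in_map => x /vm xm /=.
  have [b -> {x xm}] : exists b : 'I_m.+1, x = b.+1.
    by exists (inord x.-1); rewrite inordK; lia.
  by rewrite /= inord_val addSn /= [b + _]addnC perm_comp_inv_in; lia.
(* A letter that is not substituted undergoes exactly the shift [bump_over] used to define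
   [perm_comp]. *)
have bump_comp p (c b : 'I_p.+1) w : b != c ->
    word_comp m.+1 c.+1 [:: b.+1] w = [:: (bump_over m c b).+1].
  rewrite -val_eqE /bump_over /= => bc.
  case: (ltngtP b c) bc => // bc _; first by rewrite word_comp_lt.
  by rewrite word_comp_gt.
rewrite !bump_comp //=; first by rewrite perm_comp_inv_out.
by apply: contra asi => /eqP <-; rewrite permKV.
Qed.

(** * The operad axioms *)

Theorem theorem2p3 (K : fieldType) :
  symmetric_operad (@PAs_comp K) (@PAs_act K) (PAs_unit K).
Proof.
have compl := PAs_comp_linearl; have compr := PAs_comp_linearr.
split.
- by move=> n m i a x x' y; apply: PAs_comp_linearl.
- by move=> n m i a x y y'; apply: PAs_comp_linearr.
- move=> n m p i j x y z.
  have castl := @cast_linear K (PAs K) _ _ (esym (addnA n m p)).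
  (* The arguments become basis elements one at a time, each time checking that both sides are
     linear in that argument while the later ones stay arbitrary. *)
  move: x; apply: linear_basis_ext => [||u].
  + exact: compl.
  + by apply: linear_comp castl _; apply: linear_comp; apply: compl.
  move: y; apply: linear_basis_ext => [||v].
  + by apply: linear_comp; [apply: compr|apply: compl].
  + by apply: linear_comp castl _; apply: linear_comp; [apply: compl|apply: compr].
  move: z; apply: linear_basis_ext => [||w].
  + by apply: linear_comp; apply: compr.
  + by apply: linear_comp castl _; apply: compr.
  rewrite -!/(E K _) !PAs_compE; apply/esym/cast_E => /=.
  (* The index [i + j] is at most [n + m], so [inord] does not fall back to its default. *)
  rewrite inordK; last by have := ltn_ord i; have := ltn_ord j; lia.
  by rewrite -word_comp_seq ?packed_letters_gt0 // -ltnS.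
- move=> n m p i j x y z ij.
  have castl := @cast_linear K (PAs K) _ _ (addnAC n m p).
  move: x; apply: linear_basis_ext => [||u].
  + by apply: linear_comp; apply: compl.
  + by apply: linear_comp castl _; apply: linear_comp; apply: compl.
  move: y; apply: linear_basis_ext => [||v].
  + exact: compr.
  + by apply: linear_comp castl _; apply: linear_comp; [apply: compl|apply: compr].
  move: z; apply: linear_basis_ext => [||w].
  + by apply: linear_comp; [apply: compl|apply: compr].
  + by apply: linear_comp castl _; apply: compr.
  rewrite -!/(E K _) !PAs_compE; apply/esym/cast_E => /=.
  rewrite !inordK; try by have := ltn_ord i; have := ltn_ord j; lia.
  by rewrite -word_comp_par ?packed_letters_gt0 ?packed_letters.
(* The arity [0 + n] reduces to [n], so unlike the right unit law this one involves no cast. *)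
- move=> n; apply: linear_basis_ext => [||u]; first exact: compr.
    by [].
  rewrite -!/(E K _) PAs_compE; congr (E K _); apply: val_inj => /=.
  exact: word_comp_unitl.
- move=> n i; apply: linear_basis_ext => [||u] //.
    by apply: linear_comp (@cast_linear _ _ _ _ _) _; apply: compl.
  rewrite -!/(E K _) PAs_compE; apply: cast_E => /=.
  exact: word_comp_unitr.
- by move=> n s a x y; apply: PAs_act_linear.
- move=> n; apply: linear_basis_ext => [||u] //; first exact: PAs_act_linear.
  rewrite -!/(E K _) PAs_actE; congr (E K _); apply: val_inj => /=.
  exact/word_act1/packed_letters.
- move=> n s t; apply: linear_basis_ext => [||u].
  + by apply: linear_comp; apply: PAs_act_linear.
  + exact: PAs_act_linear.
  rewrite -!/(E K _) !PAs_actE; congr (E K _); apply: val_inj => /=.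
  exact: word_actM.
- move=> n m i s t x y.
  move: x; apply: linear_basis_ext => [||u].
  + by apply: linear_comp; [apply: compl|apply: PAs_act_linear].
  + by apply: linear_comp; [apply: PAs_act_linear|apply: compl].
  move: y; apply: linear_basis_ext => [||v].
  + by apply: linear_comp; [apply: compr|apply: PAs_act_linear].
  + by apply: linear_comp; [apply: PAs_act_linear|apply: compr].
  rewrite -!/(E K _) !PAs_actE !PAs_compE PAs_actE.
  congr (E K _); apply: val_inj => /=.
  by rewrite word_comp_equivariant ?packed_letters.
Qed.
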